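(* Let $\mathcal{A}\mathrm{LR}$ be the operad governed by the variety of $\mathcal{A}\mathrm{LR}$-algebras. Then the dual operad $\mathcal{A}\mathrm{LR}^!$ is the operad governed by the variety of $\mathcal{A}\mathrm{LR}$-algebras.
   Context: The base field is $\mathbb{C}$. An $\mathcal{A}\mathrm{LR}$-algebra (antibicommutative algebra) is an algebra $(A,\cdot)$ with a bilinear multiplication satisfying $x\cdot(y\cdot z)+y\cdot(x\cdot z)=0$ and $(x\cdot y)\cdot z+(x\cdot z)\cdot y=0$ for all $x,y,z$. The operad governed by a variety defined by multilinear identities of degree $3$ in one binary operation (without symmetry) is the corresponding binary quadratic operad. For such an operad $\mathcal{P}$, $\mathcal{P}^!$ denotes its quadratic (Koszul) dual operad in the sense of Ginzburg–Kapranov; equivalently, $\mathcal{P}^!$-algebras are defined by exactly the degree-3 identities on $(B,\bullet)$ needed so that for every $\mathcal{P}$-algebra $(A,\cdot)$ the space $A\otimes B$ with bracket $[a\otimes x,b\otimes y]=(a\cdot b)\otimes(x\bullet y)-(b\cdot a)\otimes(y\bullet x)$ is a Lie algebra. *)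

(* Defs.v *)
From HB Require Import structures.
From mathcomp Require Import all_boot all_order all_fingroup all_algebra.
From mathcomp Require Import ring_quotient generic_quotient boolp.

Set Implicit Arguments.
Unset Strict Implicit.
Unset Printing Implicit Defensive.

Import GRing.Theory.
Local Open Scope ring_scope.
Local Open Scope quotient_scope.

Section LmodQuotient.
Variables (K : fieldType) (V : lmodType K) (S : {pred V}).
Hypothesis hS : submod_closed S.

Definition quot_pred : zmodClosed V :=
  HB.pack_for (zmodClosed V) (fun v : V => v \in S)
    (GRing.isZmodClosed.Build V (fun v : V => v \in S)
       (GRing.submod_closedB hS)).

Definition quotmod : Type := Quotient.quot quot_pred.
Local Notation Q := quotmod.

HB.instance Definition _ := GRing.Zmodule.on quotmod.

Definition qcls (v : V) : Q := \pi_(Quotient.quot quot_pred) v.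
Definition qrep (x : Q) : V := repr (x : Quotient.quot quot_pred).

Lemma qrepK x : qcls (qrep x) = x. Proof. exact: reprK. Qed.

Lemma qcls_eqP u v : qcls u = qcls v <-> u - v \in S.
Proof.
rewrite -[u - v \in S]/(u - v \in quot_pred) Quotient.idealrBE.
by split=> [/eqP|/eqP].
Qed.

Lemma qclsD u v : qcls (u + v) = qcls u + qcls v.
Proof. by rewrite /qcls !piE. Qed.

Definition qscale (a : K) (x : Q) : Q := qcls (a *: qrep x).

Lemma qclsZ a v : qcls (a *: v) = qscale a (qcls v).
Proof.
apply/qcls_eqP; rewrite -scalerBr; case: hS => S0 SD.
rewrite -[_ *: _]addr0; apply: (SD) => //.
by apply/qcls_eqP; rewrite qrepK.
Qed.

Fact qscaleA a b x : qscale a (qscale b x) = qscale (a * b) x.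
Proof. by rewrite -[x]qrepK -!qclsZ scalerA. Qed.
Fact qscale1 : left_id 1 qscale.
Proof. by move=> x; rewrite -[x]qrepK -qclsZ scale1r. Qed.
Fact qscaleDr : right_distributive qscale +%R.
Proof.
by move=> a x y; rewrite -[x]qrepK -[y]qrepK -qclsD -!qclsZ -qclsD scalerDr.
Qed.
Fact qscaleDl v : {morph qscale^~ v : a b / a + b}.
Proof. by move=> a b; rewrite -[v]qrepK -!qclsZ -qclsD scalerDl. Qed.

HB.instance Definition _ := GRing.Zmodule_isLmodule.Build K Q
  qscaleA qscale1 qscaleDr qscaleDl.

Lemma qcls_linear : linear qcls.
Proof. by move=> a u v; rewrite qclsD qclsZ. Qed.

End LmodQuotient.

(* Index set of the partial composite l o_a m: the input a of l is replaced  *)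
(* by the inputs of m.                                                       *)
Definition punc (A : finType) (a : A) : finType := {x : A | x != a}.
Definition Punc (A : finType) (a x : A) (xa : x != a) : punc a :=
  exist (fun x => is_true (x != a)) x xa.
Definition plug (A : finType) (a : A) (B : finType) : finType :=
  (punc a + B)%type.

(* Symmetric operads in K-vector spaces, with partial compositions.          *)
(* Operations are indexed by finite sets rather than by integers: P(n) is    *)
(* P 'I_n, the symmetric group acts through the functoriality in bijections, *)
(* and equivariance is naturality. In the axioms below, the conditions on h  *)
(* determine the canonical bijection h between the two index sets.           *)
Record operad (K : fieldType) := Operad {
  ops :> finType -> lmodType K;
  act : forall (A B : finType) (h : A -> B), bijective h -> ops A -> ops B;
  one : ops unit;
  circ : forall (A B : finType) (a : A), ops A -> ops B -> ops (plug a B);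
  act_linear : forall A B h (hh : bijective h), linear (@act A B h hh);
  act_id : forall (A : finType) (h : A -> A) (hh : bijective h) l,
    h =1 id -> act hh l = l;
  act_comp : forall (A B C : finType) (f : A -> B) (g : B -> C) (h : A -> C)
    (hf : bijective f) (hg : bijective g) (hh : bijective h) l,
    h =1 g \o f -> act hh l = act hg (act hf l);
  circ_linearl : forall (A B : finType) (a : A) m, linear (fun l => @circ A B a l m);
  circ_linearr : forall (A B : finType) (a : A) l, linear (@circ A B a l);
  circ_nat : forall (A A' B B' : finType) (a : A) (f : A -> A') (g : B -> B')
    (h : plug a B -> plug (f a) B')
    (hf : bijective f) (hg : bijective g) (hh : bijective h) l m,
    (forall (x : punc a) (y : punc (f a)),
       val y = f (val x) -> h (inl x) = inl y) ->
    (forall b, h (inr b) = inr (g b)) ->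
    act hh (circ a l m) = circ (f a) (act hf l) (act hg m);
  circ_one : forall (A : finType) (a : A) (h : plug a unit -> A)
    (hh : bijective h) l,
    (forall x, h (inl x) = val x) -> h (inr tt) = a ->
    act hh (circ a l one) = l;
  one_circ : forall (B : finType) (h : plug tt B -> B) (hh : bijective h) m,
    (forall b, h (inr b) = b) -> act hh (circ tt one m) = m;
  circ_seq : forall (A B C : finType) (a : A) (b : B)
    (h : plug (inr b : plug a B) C -> plug a (plug b C))
    (hh : bijective h) l m n,
    (forall (z : punc (inr b : plug a B)) (x : punc a),
       val z = inl x -> h (inl z) = inl x) ->
    (forall (z : punc (inr b : plug a B)) (y : punc b),
       val z = inr (val y) -> h (inl z) = inr (inl y)) ->
    (forall c, h (inr c) = inr (inr c)) ->
    act hh (circ (inr b : plug a B) (circ a l m) n) = circ a l (circ b m n);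
  circ_par : forall (A B C : finType) (a : A) (p : punc a) (q : punc (val p))
    (h : plug (inl p : plug a B) C -> plug (inl q : plug (val p) C) B)
    (hh : bijective h) l m n,
    val q = a ->
    (forall (z : punc (inl p : plug a B)) (x : punc a)
       (z' : punc (inl q : plug (val p) C)) (x' : punc (val p)),
       val z = inl x -> val z' = inl x' -> val x = val x' ->
       h (inl z) = inl z') ->
    (forall (z : punc (inl p : plug a B)) b, val z = inr b ->
       h (inl z) = inr b) ->
    (forall c (z' : punc (inl q : plug (val p) C)), val z' = inr c ->
       h (inr c) = inl z') ->
    act hh (circ (inl p : plug a B) (circ a l m) n) =
      circ (inl q : plug (val p) C) (circ (val p) l n) m
}.

Arguments act {K} o {A B h}.
Arguments one {K} o.
Arguments circ {K} o {A B} a.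

Record operad_iso (K : fieldType) (P Q : operad K) := OperadIso {
  iso_fun :> forall A : finType, P A -> Q A;
  iso_linear : forall A, linear (@iso_fun A);
  iso_bij : forall A, bijective (@iso_fun A);
  iso_act : forall (A B : finType) (h : A -> B) (hh : bijective h) l,
    iso_fun (act P hh l) = act Q hh (iso_fun l);
  iso_one : iso_fun (one P) = one Q;
  iso_circ : forall (A B : finType) (a : A) (l : P A) (m : P B),
    iso_fun (circ P a l m) = circ Q a (iso_fun l) (iso_fun m)
}.

Record ideal (K : fieldType) (P : operad K) := Ideal {
  imem :> forall A : finType, {pred P A};
  imem_submod : forall A, submod_closed (@imem A);
  imem_act : forall (A B : finType) (h : A -> B) (hh : bijective h) l,
    l \in @imem A -> act P hh l \in @imem B;
  imem_circl : forall (A B : finType) (a : A) (l : P A) (m : P B),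
    l \in @imem A -> circ P a l m \in @imem (plug a B);
  imem_circr : forall (A B : finType) (a : A) (l : P A) (m : P B),
    m \in @imem B -> circ P a l m \in @imem (plug a B)
}.

Arguments imem {K P} i A _ : rename.

Section GeneratedIdeal.
Variables (K : fieldType) (P : operad K) (A0 : finType) (R : {pred P A0}).

Definition gen_mem (A : finType) : {pred P A} :=
  fun l => `[< forall I : ideal P, {subset R <= I A0} -> l \in I A >].

Fact gen_submod A : submod_closed (@gen_mem A).
Proof.
split=> [|a u v /asboolP hu /asboolP hv]; apply/asboolP => I RI;
  have [I0 ID] := imem_submod I A; first exact: I0.
by apply: ID; [exact: hu | exact: hv].
Qed.

Fact gen_act (A B : finType) (h : A -> B) (hh : bijective h) l :
  l \in @gen_mem A -> act P hh l \in @gen_mem B.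
Proof.
by move=> /asboolP hl; apply/asboolP=> I RI; exact/imem_act/hl.
Qed.

Fact gen_circl (A B : finType) (a : A) (l : P A) (m : P B) :
  l \in @gen_mem A -> circ P a l m \in @gen_mem (plug a B).
Proof.
by move=> /asboolP hl; apply/asboolP=> I RI; exact/imem_circl/hl.
Qed.

Fact gen_circr (A B : finType) (a : A) (l : P A) (m : P B) :
  m \in @gen_mem B -> circ P a l m \in @gen_mem (plug a B).
Proof.
by move=> /asboolP hl; apply/asboolP=> I RI; exact/imem_circr/hl.
Qed.

Definition gen_ideal : ideal P := Ideal gen_submod gen_act gen_circl gen_circr.

End GeneratedIdeal.

Section QuotientOperad.
Variables (K : fieldType) (P : operad K) (I : ideal P).

Definition qops (A : finType) : lmodType K := quotmod (imem_submod I A).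
Definition qclass (A : finType) (l : P A) : qops A := qcls (imem_submod I A) l.
Definition qrepr (A : finType) (x : qops A) : P A := qrep x.
Definition qact (A B : finType) (h : A -> B) (hh : bijective h) (x : qops A) :
  qops B := qclass (act P hh (qrepr x)).
Definition qcirc (A B : finType) (a : A) (x : qops A) (y : qops B) :
  qops (plug a B) := qclass (circ P a (qrepr x) (qrepr y)).

Lemma qreprK A (x : qops A) : qclass (qrepr x) = x.
Proof. exact: qrepK. Qed.

Lemma qclass_eqP A (l m : P A) : qclass l = qclass m <-> l - m \in I A.
Proof. exact: qcls_eqP. Qed.

Lemma qclass_linear A : linear (@qclass A).
Proof. exact: qcls_linear. Qed.

Lemma linB (U V : lmodType K) (f : U -> V) (lf : linear f) u v :
  f (u - v) = f u - f v.
Proof. by rewrite -scaleN1r addrC lf scaleN1r addrC. Qed.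

Lemma qactE (A B : finType) (h : A -> B) (hh : bijective h) l :
  qact hh (qclass l) = qclass (act P hh l).
Proof.
apply/qclass_eqP; rewrite -(linB (act_linear (o := P) hh)).
by apply: imem_act; apply/qclass_eqP; rewrite qreprK.
Qed.

Lemma qcircE (A B : finType) (a : A) (l : P A) (m : P B) :
  qcirc a (qclass l) (qclass m) = qclass (circ P a l m).
Proof.
transitivity (qclass (circ P a l (qrepr (qclass m)))); apply/qclass_eqP.
  rewrite -(linB (circ_linearl (o := P) a _)).
  by apply: imem_circl; apply/qclass_eqP; rewrite qreprK.
rewrite -(linB (circ_linearr (o := P) a _)).
by apply: imem_circr; apply/qclass_eqP; rewrite qreprK.
Qed.

Definition quot_operad : operad K.
Proof.
apply: (@Operad K qops qact (qclass (one P)) qcirc).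
- move=> A B h hh a x y; rewrite -[x]qreprK -[y]qreprK -qclass_linear !qactE.
  by rewrite act_linear qclass_linear.
- by move=> A h hh x hE; rewrite -[x]qreprK qactE act_id.
- move=> A B C f g h hf hg hh x hE; rewrite -[x]qreprK !qactE.
  by rewrite (act_comp hf hg hh).
- move=> A B a z k x y /=; rewrite -[x]qreprK -[y]qreprK -[z]qreprK.
  by rewrite -qclass_linear !qcircE circ_linearl qclass_linear.
- move=> A B a z k x y /=; rewrite -[x]qreprK -[y]qreprK -[z]qreprK.
  by rewrite -qclass_linear !qcircE circ_linearr qclass_linear.
- move=> A A' B B' a f g h hf hg hh x y h1 h2.
  rewrite -[x]qreprK -[y]qreprK (qactE hf) (qactE hg) !qcircE (qactE hh).
  by rewrite (circ_nat hf hg).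
- move=> A a h hh x h1 h2; rewrite -[x]qreprK qcircE qactE.
  by rewrite circ_one.
- move=> B h hh x h1; rewrite -[x]qreprK qcircE qactE.
  by rewrite one_circ.
- move=> A B C a b h hh x y z h1 h2 h3.
  rewrite -[x]qreprK -[y]qreprK -[z]qreprK !qcircE qactE.
  by rewrite circ_seq.
- move=> A B C a p q h hh x y z h0 h1 h2 h3.
  rewrite -[x]qreprK -[y]qreprK -[z]qreprK !qcircE qactE.
  by rewrite (circ_par (q := q)).
Defined.

End QuotientOperad.

(* Nonassociative monomials in the variables A. *)
Inductive tree (A : Type) := Leaf of A | Node of tree A & tree A.

Fixpoint leaves A (t : tree A) : seq A :=
  match t with
  | Leaf a => [:: a]
  | Node l r => leaves l ++ leaves r
  end.

Fixpoint tbind A B (t : tree A) (k : A -> tree B) : tree B :=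
  match t with
  | Leaf a => k a
  | Node l r => Node (tbind l k) (tbind r k)
  end.

Definition tmap A B (h : A -> B) (t : tree A) : tree B :=
  tbind t (fun a => Leaf (h a)).

Section TreeInstances.

Fixpoint tree_encode A (t : tree A) : GenTree.tree A :=
  match t with
  | Leaf a => GenTree.Leaf a
  | Node l r => GenTree.Node 0 [:: tree_encode l; tree_encode r]
  end.

Fixpoint tree_decode A (t : GenTree.tree A) : option (tree A) :=
  match t with
  | GenTree.Leaf a => Some (Leaf a)
  | GenTree.Node _ [:: l; r] =>
      match tree_decode l, tree_decode r with
      | Some l', Some r' => Some (Node l' r')
      | _, _ => None
      end
  | _ => None
  end.

Lemma tree_encodeK A : pcancel (@tree_encode A) (@tree_decode A).
Proof. by elim=> [a|l IHl r IHr] //=; rewrite IHl IHr. Qed.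

HB.instance Definition _ (A : eqType) :=
  Equality.copy (tree A) (pcan_type (@tree_encodeK A)).
HB.instance Definition _ (A : choiceType) :=
  Choice.copy (tree A) (pcan_type (@tree_encodeK A)).
HB.instance Definition _ (A : countType) :=
  Countable.copy (tree A) (pcan_type (@tree_encodeK A)).

End TreeInstances.

(* Multilinear monomials: every variable occurs exactly once. *)
Definition multilin (A : finType) (t : tree A) : bool :=
  [forall x, count_mem x (leaves t) == 1%N].

Definition mtree (A : finType) := {t : tree A | multilin t}.
HB.instance Definition _ (A : finType) := Countable.on (mtree A).
Definition MTree (A : finType) (t : tree A) (ht : multilin t) : mtree A :=
  exist (fun t => is_true (multilin t)) t ht.

Section MtreeFinite.
Variable A : finType.

Fixpoint trees_upto (d : nat) : seq (tree A) :=
  if d is d'.+1 then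
    [seq Leaf a | a <- enum A] ++
    [seq Node l r | l <- trees_upto d', r <- trees_upto d']
  else [::].

Lemma leaves_gt0 (t : tree A) : (0 < size (leaves t))%N.
Proof.
by elim: t => //= l IHl r IHr; rewrite size_cat addn_gt0 IHl.
Qed.

Lemma mem_trees_upto d (t : tree A) :
  (size (leaves t) <= d)%N -> t \in trees_upto d.
Proof.
elim: d t => [|d IH] t; first by rewrite leqNgt leaves_gt0.
case: t => [a _|l r] /=.
  by rewrite mem_cat map_f // mem_enum.
rewrite size_cat => lr; rewrite mem_cat; apply/orP; right.
apply: allpairs_f; apply: IH; rewrite -ltnS; apply: leq_trans lr.
  by rewrite -[X in (X < _)%N]addn0 ltn_add2l leaves_gt0.
by rewrite -[X in (X < _)%N]add0n ltn_add2r leaves_gt0.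
Qed.

Lemma multilin_perm (t : tree A) : multilin t -> perm_eq (leaves t) (enum A).
Proof.
move=> /forallP ht; apply/allP => x _ /=.
by rewrite (eqP (ht x)) count_uniq_mem ?enum_uniq // mem_enum.
Qed.

Definition mtree_enum : seq (mtree A) :=
  undup (pmap insub (trees_upto #|A|)).

Lemma mtree_enumP : Finite.axiom mtree_enum.
Proof.
apply: Finite.uniq_enumP; first exact: undup_uniq.
move=> t; rewrite mem_undup mem_pmap_sub inE; apply: mem_trees_upto.
by rewrite (perm_size (multilin_perm (valP t))) -cardE.
Qed.

HB.instance Definition _ := isFinite.Build (mtree A) mtree_enumP.
End MtreeFinite.

Section TreeTheory.

Lemma eq_tbind A B (k k' : A -> tree B) : k =1 k' ->
  forall t, tbind t k = tbind t k'.
Proof. by move=> kk; elim=> //= l -> r ->. Qed.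

Lemma tbind_bind A B C (k : A -> tree B) (k' : B -> tree C) t :
  tbind (tbind t k) k' = tbind t (fun x => tbind (k x) k').
Proof. by elim: t => //= l -> r ->. Qed.

Lemma tbind_leaf A (t : tree A) : tbind t (@Leaf A) = t.
Proof. by elim: t => //= l -> r ->. Qed.

Lemma count_tbind (A B : eqType) (p : pred B) (k : A -> tree B) t :
  count p (leaves (tbind t k)) =
  (\sum_(x <- leaves t) count p (leaves (k x)))%N.
Proof.
elim: t => [a|l IHl r IHr] /=; first by rewrite big_seq1.
by rewrite count_cat IHl IHr big_cat.
Qed.

Lemma count_mtree (A B : finType) (p : pred B) (k : A -> tree B) t :
  multilin t ->
  count p (leaves (tbind t k)) = (\sum_x count p (leaves (k x)))%N.
Proof.
move=> /multilin_perm ht; rewrite count_tbind (perm_big _ ht) /=.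
by rewrite big_enum.
Qed.

Lemma multilin_map (A B : finType) (h : A -> B) (hh : bijective h) t :
  multilin t -> multilin (tmap h t).
Proof.
move=> ht; apply/forallP=> y; rewrite (count_mtree _ _ ht) /=.
have [g hK gK] := hh; rewrite (bigD1 (g y)) //= gK eqxx big1 // => x xy.
by rewrite addn0; case: eqP => // hxy; rewrite -hxy hK eqxx in xy.
Qed.

End TreeTheory.

Definition mt_map (A B : finType) (h : A -> B) (hh : bijective h)
  (t : mtree A) : mtree B := MTree (multilin_map hh (valP t)).

Section Graft.
Variables (A B : finType) (a : A).

Definition graft_at (u : tree B) (x : A) : tree (plug a B) :=
  if insub x is Some x' then Leaf (inl (x' : punc a)) else tmap inr u.

Definition graft (s : tree A) (u : tree B) : tree (plug a B) :=
  tbind s (graft_at u).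

Lemma graft_atT u : graft_at u a = tmap inr u.
Proof. by rewrite /graft_at insubF ?eqxx. Qed.

Lemma graft_atF u (x : punc a) : graft_at u (val x) = Leaf (inl x).
Proof. by rewrite /graft_at valK. Qed.

Lemma punc_cases (x : A) : x = a \/ exists y : punc a, x = val y.
Proof.
have [->|xa] := eqVneq x a; [by left | right].
by exists (Punc xa).
Qed.

Lemma multilin_graft s u : multilin s -> multilin u -> multilin (graft s u).
Proof.
move=> hs hu; apply/forallP=> z; rewrite (count_mtree _ _ hs).
case: z => [x|b].
  rewrite (bigD1 (val x)) //= graft_atF /= eqxx big1 // => y yx.
  have [->|[y' Ey]] := punc_cases y.
    by rewrite graft_atT (count_mtree _ _ hu) big1.
  rewrite Ey graft_atF /= addn0; case: eqP => // -[] y'x.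
  by rewrite Ey y'x eqxx in yx.
rewrite (bigD1 a) //= graft_atT (count_mtree _ _ hu) (bigD1 b) //= eqxx.
rewrite !big1 // => [y ya|y yb]; last first.
  by rewrite addn0; case: eqP => // -[] y'b; rewrite y'b eqxx in yb.
have [Ey|[y' ->]] := punc_cases y; first by rewrite Ey eqxx in ya.
by rewrite graft_atF.
Qed.

Definition mt_graft (s : mtree A) (u : mtree B) : mtree (plug a B) :=
  MTree (multilin_graft (valP s) (valP u)).

End Graft.

Section FreeVect.
Variable K : fieldType.

Definition fvect (S : finType) : lmodType K := {ffun S -> K^o}.
Definition delta (S : finType) (s : S) : fvect S := [ffun t => (t == s)%:R].
Definition push (S T : finType) (f : S -> T) (x : fvect S) : fvect T :=
  [ffun t => \sum_(s | f s == t) x s].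
Definition tens (S T : finType) (x : fvect S) (y : fvect T) :
  fvect (S * T)%type := [ffun p => x p.1 * y p.2].

Lemma push_linear (S T : finType) (f : S -> T) : linear (push f).
Proof.
move=> a x y; apply/ffunP => t; rewrite !ffunE scaler_sumr -big_split /=.
by apply: eq_bigr => s _; rewrite !ffunE.
Qed.

Lemma eq_push (S T : finType) (f g : S -> T) : f =1 g -> push f =1 push g.
Proof.
move=> fg x; apply/ffunP => t; rewrite !ffunE.
by apply: eq_bigl => s; rewrite fg.
Qed.

Lemma push_id S x : @push S S id x = x.
Proof. by apply/ffunP => t; rewrite ffunE big_pred1_eq. Qed.

Lemma push_comp (S T U : finType) (f : S -> T) (g : T -> U) (x : fvect S) :
  push g (push f x) = push (g \o f) x.
Proof.
apply/ffunP => u; rewrite !ffunE.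
rewrite [RHS](partition_big f (fun t => g t == u)) //=.
apply: eq_bigr => t gt; rewrite ffunE; apply: eq_bigl => s.
by case: eqP => [->|]; rewrite ?gt ?andbT ?andbF.
Qed.

Lemma push_delta (S T : finType) (f : S -> T) s :
  push f (delta s) = delta (f s).
Proof.
apply/ffunP => t; rewrite !ffunE; under eq_bigr do rewrite ffunE.
have [->|ne] := eqVneq t (f s).
  rewrite (bigD1 s) //= eqxx big1 ?addr0 // => r /andP[_ /negbTE rs].
  by rewrite rs.
rewrite big1 // => r /eqP fr; case: eqP => // rs.
by rewrite -fr rs eqxx in ne.
Qed.

Lemma tens_linearl (S T : finType) (y : fvect T) :
  linear (fun x : fvect S => tens x y).
Proof.
by move=> a x x'; apply/ffunP => p; rewrite !ffunE mulrDl -scalerAl.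
Qed.

Lemma tens_linearr (S T : finType) (x : fvect S) :
  linear (fun y : fvect T => tens x y).
Proof.
by move=> a y y'; apply/ffunP => p; rewrite !ffunE mulrDr -scalerAr.
Qed.

Lemma tens_push (S S' T T' : finType) (f : S -> S') (g : T -> T')
  (x : fvect S) (y : fvect T) :
  tens (push f x) (push g y) = push (fun p => (f p.1, g p.2)) (tens x y).
Proof.
apply/ffunP => -[s t]; rewrite !ffunE /= big_distrlr /= pair_big /=.
by apply: eq_big => [[u v]|[u v] _]; rewrite ?ffunE //= xpair_eqE.
Qed.

Lemma tens_assoc S T U (x : fvect S) (y : fvect T) (z : fvect U) :
  tens x (tens y z) = push (fun p => (p.1.1, (p.1.2, p.2))) (tens (tens x y) z).
Proof.
apply/ffunP => -[s [t u]]; rewrite !ffunE /=.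
rewrite (big_pred1 ((s, t), u)) ?ffunE ?mulrA //.
by move=> [[s' t'] u'] /=; rewrite !xpair_eqE andbA.
Qed.

Lemma tens_comm23 S T U (x : fvect S) (y : fvect T) (z : fvect U) :
  tens (tens x z) y =
  push (fun p => ((p.1.1, p.2), p.1.2)) (tens (tens x y) z).
Proof.
apply/ffunP => -[[s u] t]; rewrite !ffunE /=.
rewrite (big_pred1 ((s, t), u)) ?ffunE ?mulrA //=; first by rewrite mulrAC.
by move=> [[s' t'] u'] /=; rewrite !xpair_eqE andbAC.
Qed.

Lemma tens_deltar (S T : finType) (x : fvect S) (t : T) :
  tens x (delta t) = push (fun s => (s, t)) x.
Proof.
apply/ffunP => -[s t']; rewrite !ffunE /=.
have [->|ne] := eqVneq t' t.
  rewrite mulr1 (big_pred1 s) // => s'.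
  by rewrite xpair_eqE eqxx andbT.
rewrite mulr0 big_pred0 // => s'; rewrite xpair_eqE [t == _]eq_sym.
by rewrite (negbTE ne) andbF.
Qed.

Lemma tens_deltal (S T : finType) (s : S) (y : fvect T) :
  tens (delta s) y = push (fun t => (s, t)) y.
Proof.
apply/ffunP => -[s' t]; rewrite !ffunE /=.
have [->|ne] := eqVneq s' s.
  rewrite mul1r (big_pred1 t) // => t'.
  by rewrite xpair_eqE eqxx.
rewrite mul0r big_pred0 // => t'; rewrite xpair_eqE [s == _]eq_sym.
by rewrite (negbTE ne).
Qed.

End FreeVect.

(* The free operad F(E) on one binary operation mu without symmetry, that is *)
(* on the regular representation E of S_2: the operations with inputs A are  *)
(* the multilinear nonassociative polynomials in A.                          *)
Section Magmatic.
Variable K : fieldType.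

Definition mag_ops (A : finType) : lmodType K := fvect K (mtree A).
Definition mag_act (A B : finType) (h : A -> B) (hh : bijective h) :
  mag_ops A -> mag_ops B := push (mt_map hh).
Definition mag_circ (A B : finType) (a : A) (l : mag_ops A) (m : mag_ops B) :
  mag_ops (plug a B) := push (fun p => mt_graft a p.1 p.2) (tens l m).

Fact multilin_one : multilin (Leaf tt).
Proof. by apply/forallP => -[]. Qed.
Definition mag_one : mag_ops unit := delta K (MTree multilin_one).

Definition mag : operad K.
Proof.
apply: (@Operad K mag_ops mag_act mag_one mag_circ).
- by move=> A B h hh; exact: push_linear.
- move=> A h hh l hE; rewrite /mag_act (eq_push (g := id)) ?push_id // => t.
  apply: val_inj => /=; rewrite -[RHS]tbind_leaf; apply: eq_tbind => x.
  by rewrite hE.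
- move=> A B C f g h hf hg hh l hE; rewrite /mag_act push_comp.
  apply: eq_push => t; apply: val_inj; rewrite /= /tmap tbind_bind.
  by apply: eq_tbind => x /=; rewrite hE.
- by move=> A B a m k x y /=; rewrite /mag_circ tens_linearl push_linear.
- by move=> A B a m k x y /=; rewrite /mag_circ tens_linearr push_linear.
- move=> A A' B B' a f g h hf hg hh l m h1 h2.
  rewrite /mag_circ /mag_act tens_push !push_comp.
  apply: eq_push => -[s u]; apply: val_inj => /=.
  rewrite /tmap /graft !tbind_bind; apply: eq_tbind => x /=.
  have [->|[y ->]] := punc_cases a x.
    rewrite !graft_atT /tmap !tbind_bind; apply: eq_tbind => b /=.
    by rewrite h2.
  have fy : f (val y) != f a by rewrite (bij_eq hf) (valP y).
  pose y' : punc (f a) := Punc fy.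
  by rewrite -[f (val y)]/(val y') !graft_atF /= (h1 y y').
- move=> A a h hh l h1 h2; rewrite /mag_circ /mag_act tens_deltar !push_comp.
  rewrite (eq_push (g := id)) ?push_id // => t; apply: val_inj => /=.
  rewrite /tmap tbind_bind -[RHS]tbind_leaf; apply: eq_tbind => x.
  by have [->|[y ->]] := punc_cases a x; rewrite ?graft_atT ?graft_atF /= ?h1 ?h2.
- move=> B h hh m h1; rewrite /mag_circ /mag_act tens_deltal !push_comp.
  rewrite (eq_push (g := id)) ?push_id // => t; apply: val_inj => /=.
  rewrite /tmap /graft /= graft_atT /tmap tbind_bind -[RHS]tbind_leaf.
  by apply: eq_tbind => x /=; rewrite h1.
- move=> A B C a b h hh l m n h1 h2 h3.
  rewrite /mag_circ /mag_act -{1}[n]push_id -{2}[l]push_id !tens_push tens_assoc.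
  rewrite !push_comp; apply: eq_push => -[[s u] v]; apply: val_inj => /=.
  rewrite /tmap /graft !tbind_bind; apply: eq_tbind => x /=.
  have [->|[y ->]] := punc_cases a x.
    rewrite !graft_atT /tmap /graft !tbind_bind; apply: eq_tbind => z /=.
    have [->|[w ->]] := punc_cases b z.
      rewrite !graft_atT /tmap !tbind_bind; apply: eq_tbind => c /=.
      by rewrite h3.
    have wb : (inr (val w) : plug a B) != inr b.
      by apply/eqP => -[] wb; have := valP w; rewrite /= wb eqxx.
    pose w' : punc (inr b : plug a B) := Punc wb.
    by rewrite -[inr (val w)]/(val w') !graft_atF /= (h2 w' w).
  have yb : (inl y : plug a B) != inr b by [].
  pose y' : punc (inr b : plug a B) := Punc yb.
  rewrite !graft_atF /= -[inl y]/(val y') !graft_atF /=.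
  by rewrite (h1 y' y).
- move=> A B C a p q h hh l m n qa h1 h2 h3.
  rewrite /mag_circ /mag_act -{1}[n]push_id -{2}[m]push_id !tens_push tens_comm23.
  rewrite !push_comp; apply: eq_push => -[[s u] v]; apply: val_inj => /=.
  rewrite /tmap /graft !tbind_bind; apply: eq_tbind => x /=.
  have [->|[y Ey]] := punc_cases a x.
    rewrite graft_atT -[X in graft_at (val p) _ X]qa graft_atF /= graft_atT.
    rewrite /tmap !tbind_bind; apply: eq_tbind => b /=.
    have bp : (inr b : plug a B) != inl p by [].
    pose b' : punc (inl p : plug a B) := Punc bp.
    by rewrite -[inr b]/(val b') graft_atF /= (h2 b' b).
  have [Ex|[y' Ey']] := punc_cases (val p) x.
    rewrite Ex graft_atT graft_atF /= graft_atT /tmap !tbind_bind.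
    apply: eq_tbind => c /=.
    have cq : (inr c : plug (val p) C) != inl q by [].
    pose c' : punc (inl q : plug (val p) C) := Punc cq.
    by rewrite (h3 c c') // -[inr c]/(val c') graft_atF.
  have yp : (inl y : plug a B) != inl p.
    apply/eqP => -[] yp; have := valP y'; rewrite /= -Ey' Ey yp.
    by rewrite eqxx.
  have yq : (inl y' : plug (val p) C) != inl q.
    apply/eqP => -[] yq; have := valP y; rewrite /= -Ey Ey' yq qa.
    by rewrite eqxx.
  pose z : punc (inl p : plug a B) := Punc yp.
  pose z' : punc (inl q : plug (val p) C) := Punc yq.
  rewrite {1}Ey Ey' !graft_atF /= -[inl y]/(val z) -[inl y']/(val z').
  by rewrite !graft_atF /= (h1 z y z' y') // -Ey -Ey'.
Defined.

Fact multilin_mu : multilin (Node (Leaf (0 : 'I_2)) (Leaf 1)).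
Proof. by apply/forallP => -[[|[|]]]. Qed.

Definition mag_mu : mag 'I_2 := delta K (MTree multilin_mu).

(* The 12 monomials of degree 3: lcomb s is (x_s0 x_s1) x_s2 and rcomb s is  *)
(* x_s0 (x_s1 x_s2).                                                         *)
Fact multilin_lcomb :
  multilin (Node (Node (Leaf (0 : 'I_3)) (Leaf 1)) (Leaf 2)).
Proof. by apply/forallP => -[[|[|[|]]]]. Qed.

Fact multilin_rcomb :
  multilin (Node (Leaf (0 : 'I_3)) (Node (Leaf 1) (Leaf 2))).
Proof. by apply/forallP => -[[|[|[|]]]]. Qed.

Definition lcomb (s : 'S_3) : mtree 'I_3 :=
  mt_map (injF_bij (@perm_inj _ s)) (MTree multilin_lcomb).
Definition rcomb (s : 'S_3) : mtree 'I_3 :=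
  mt_map (injF_bij (@perm_inj _ s)) (MTree multilin_rcomb).

(* The 12 monomials of degree 3: lcomb s is (x_s0 x_s1) x_s2 and rcomb s is  *)
(* x_s0 (x_s1 x_s2).                                                         *)


End Magmatic.

(* A binary quadratic operad F(E)/(R) is given by its S_3-submodule R of     *)
(* F(E)(3).                                                                  *)
Record quad_data (K : fieldType) := QuadData {
  qrel :> {pred mag K 'I_3};
  qrel_submod : submod_closed qrel;
  qrel_act : forall (h : 'I_3 -> 'I_3) (hh : bijective h) l,
    l \in qrel -> act (mag K) hh l \in qrel
}.

Definition quad_operad (K : fieldType) (R : quad_data K) : operad K :=
  quot_operad (gen_ideal R).

Definition quad_gen (K : fieldType) (R : quad_data K) : quad_operad R 'I_2 :=
  qclass (gen_ideal R) (mag_mu K).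

(* The quadratic dual of F(E)/(R) is F(E^v)/(R^perp), with E^v = E^* (x) sgn *)
(* and R^perp the annihilator of R for the canonical identification of       *)
(* F(E^v)(3) with F(E)(3)^* (x) sgn. Here E has basis mu, mu^op, and E^v is  *)
(* again the regular representation, generated by mu^v = mu^*, where         *)
(* (mu^v)^op = - (mu^op)^*; so F(E^v) is again mag, on the generator mu^v.   *)
(* For the three composition types (xy)z, (yz)x, (zx)y, the composite        *)
(* alpha^* o_u beta^* is dual to alpha o_u beta. As x_i (x_j x_k) is the     *)
(* composite of mu^op with mu, and as exchanging the arguments of an inner   *)
(* operation also costs a sign, distinct monomials are orthogonal,           *)
(* (x_s0 x_s1) x_s2 pairs with its namesake to sgn(s), and x_s0 (x_s1 x_s2)  *)
(* to -sgn(s). These are also the signs with which the monomials occur in    *)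
(* the Jacobian of [a (x) x, b (x) y] = ab (x) xy - ba (x) yx.               *)
Section QuadraticDual.
Variable K : fieldType.

Definition pairing (f g : mag K 'I_3) : K :=
  \sum_(s : 'S_3) (-1) ^+ s *
     ((f : fvect K _) (lcomb s) * (g : fvect K _) (lcomb s)
      - (f : fvect K _) (rcomb s) * (g : fvect K _) (rcomb s)).

Lemma pairing_linearr f a g g' :
  pairing f (a *: g + g') = a * pairing f g + pairing f g'.
Proof.
rewrite /pairing mulr_sumr -big_split /=; apply: eq_bigr => s _.
rewrite !ffunE /= mulrCA -mulrDr; congr (_ * _).
rewrite mulrBr !mulrDr opprD addrACA; congr (_ + _); congr (_ - _); exact: mulrCA.
Qed.

Lemma mt_map_inj (A B : finType) (h : A -> B) (hh : bijective h) :
  injective (mt_map hh).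
Proof.
have [g hK _] := hh => t u /(congr1 val) /= E; apply: val_inj.
rewrite -[val t]tbind_leaf -[val u]tbind_leaf.
have := congr1 (tmap g) E; rewrite /tmap !tbind_bind /=.
by do 2![rewrite (eq_tbind (k' := @Leaf A)) => [|x]; last by rewrite /= hK];
  move=> //; rewrite !tbind_leaf.
Qed.

Lemma mag_actE (A B : finType) (h : A -> B) (hh : bijective h) (f : mag K A) t :
  (act (mag K) hh f : fvect K _) (mt_map hh t) = (f : fvect K _) t.
Proof.
rewrite /= /mag_act ffunE (big_pred1 t) // => u.
exact: (inj_eq (mt_map_inj (hh := hh))).
Qed.

Lemma pairing_act (h : 'I_3 -> 'I_3) (hh : bijective h) f g :
  pairing (act (mag K) hh f) (act (mag K) hh g) =
  (-1) ^+ perm (bij_inj hh) * pairing f g.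
Proof.
set p := perm (bij_inj hh).
rewrite /pairing (reindex_inj (mulIg p)) mulr_sumr; apply: eq_bigr => s _.
have El : lcomb (s * p)%g = mt_map hh (lcomb s).
  by apply: val_inj; rewrite /= /tmap /= !permM !permE.
have Er : rcomb (s * p)%g = mt_map hh (rcomb s).
  by apply: val_inj; rewrite /= /tmap /= !permM !permE.
by rewrite El Er !mag_actE odd_permM signr_addb mulrA [_ ^+ s * _]mulrC.
Qed.

Section Perp.
Variable R : quad_data K.

Definition perp : {pred mag K 'I_3} :=
  fun g => `[< forall f, f \in (R : {pred _}) -> pairing f g = 0 >].

Fact perp_submod : submod_closed perp.
Proof.
split=> [|a g g' /asboolP h /asboolP h']; apply/asboolP => f Rf.
  have := pairing_linearr f (-1) 0 0.
  by rewrite scaler0 addr0 mulN1r addNr.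
by rewrite pairing_linearr h // h' // mulr0 addr0.
Qed.

Fact perp_act (h : 'I_3 -> 'I_3) (hh : bijective h) g :
  g \in perp -> act (mag K) hh g \in perp.
Proof.
move=> /asboolP hg; apply/asboolP => f Rf; have [h' hK h'K] := hh.
have hh' : bijective h' by exists h.
have -> : f = act (mag K) hh (act (mag K) hh' f).
  have hi : bijective (@id 'I_3) by exists id.
  by rewrite -(act_comp hh' hh hi) ?act_id // => i; rewrite /= h'K.
by rewrite pairing_act hg ?mulr0 //; apply: qrel_act.
Qed.

Definition quad_dual : quad_data K := QuadData perp_submod perp_act.

End Perp.
End QuadraticDual.

Record algebra (K : fieldType) := Algebra {
  alg_sort :> lmodType K;
  amul : alg_sort -> alg_sort -> alg_sort;
  amul_linearl : forall y, linear (fun x => amul x y);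
  amul_linearr : forall x, linear (amul x)
}.

Fixpoint teval (K : fieldType) (X : algebra K) (A : Type) (r : A -> X)
  (t : tree A) : X :=
  match t with
  | Leaf a => r a
  | Node u v => amul (teval r u) (teval r v)
  end.

Definition peval (K : fieldType) (X : algebra K) (A : finType) (r : A -> X)
  (f : mag K A) : X := \sum_t (f : fvect K _) t *: teval r (val t).

Section Variety.
Variables (K : fieldType) (V : algebra K -> Prop).

(* The multilinear identities of degree 3 satisfied by all algebras in V. *)
Definition identity3 : {pred mag K 'I_3} :=
  fun f => `[< forall X : algebra K, V X ->
                 forall r : 'I_3 -> X, peval r f = 0 >].

Lemma peval_linear (X : algebra K) (A : finType) (r : A -> X) : linear (peval r).
Proof.
move=> a f g; rewrite /peval scaler_sumr -big_split /=; apply: eq_bigr => t _.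
by rewrite !ffunE scalerDl scalerA.
Qed.

Lemma teval_bind (X : algebra K) A B (k : A -> tree B) (r : B -> X) t :
  teval r (tbind t k) = teval (fun a => teval r (k a)) t.
Proof. by elim: t => //= u -> v ->. Qed.

Lemma eq_teval (X : algebra K) A (r r' : A -> X) :
  r =1 r' -> teval r =1 teval r'.
Proof. by move=> rr; elim=> //= u -> v ->. Qed.

Lemma peval_delta (X : algebra K) (A : finType) (r : A -> X) t :
  peval r (delta K t) = teval r (val t).
Proof.
rewrite /peval (bigD1 t) //= big1 => [|u /negbTE ut]; rewrite ffunE.
  by rewrite eqxx scale1r addr0.
by rewrite ut scale0r.
Qed.

Lemma peval_act (X : algebra K) (A B : finType) (h : A -> B) (hh : bijective h)
  (r : B -> X) f : peval r (act (mag K) hh f) = peval (r \o h) f.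
Proof.
rewrite /peval.
transitivity (\sum_t \sum_(s | mt_map hh s == t)
   (f : fvect K _) s *: teval r (val (mt_map hh s))).
  apply: eq_bigr => t _; rewrite ffunE scaler_suml; apply: eq_bigr.
  by move=> s /eqP ->.
rewrite [RHS](partition_big (mt_map hh) xpredT) //=.
by apply: eq_bigr => t _; apply: eq_bigr => s _; rewrite teval_bind.
Qed.

Fact identity3_submod : submod_closed identity3.
Proof.
have lin0 (X : algebra K) (r : 'I_3 -> X) : peval r 0 = 0.
  by rewrite /peval big1 // => t _; rewrite ffunE scale0r.
split=> [|a f g /asboolP hf /asboolP hg]; apply/asboolP => X VX r //.
by rewrite peval_linear hf // hg // scaler0 addr0.
Qed.

Fact identity3_act (h : 'I_3 -> 'I_3) (hh : bijective h) f :
  f \in identity3 -> act (mag K) hh f \in identity3.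
Proof.
by move=> /asboolP hf; apply/asboolP => X VX r; rewrite peval_act hf.
Qed.

Definition variety_rel : quad_data K := QuadData identity3_submod identity3_act.

(* V is the variety defined by its multilinear identities of degree 3. *)
Definition quadratic_variety : Prop := forall X : algebra K,
  V X <-> (forall f, f \in identity3 -> forall r : 'I_3 -> X, peval r f = 0).

End Variety.

(* The binary quadratic operad of V; it is the operad of multilinear parts   *)
(* of the free V-algebras when V satisfies quadratic_variety.                *)
Definition governed_operad (K : fieldType) (V : algebra K -> Prop) : operad K :=
  quad_operad (variety_rel V).

(* The quadratic dual of governed_operad V. *)
Definition dual_operad (K : fieldType) (V : algebra K -> Prop) : operad K :=
  quad_operad (quad_dual (variety_rel V)).

Definition is_ALR (K : fieldType) (X : algebra K) : Prop :=
  (forall x y z : X, amul x (amul y z) + amul y (amul x z) = 0) /\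
  (forall x y z : X, amul (amul x y) z + amul (amul x z) y = 0).

Lemma ALR_quadratic (K : fieldType) : quadratic_variety (@is_ALR K).
Proof.
move=> X; split=> [hX f /asboolP hf r|hX]; first exact: hf.
pose r (x y z : X) := fun i : 'I_3 => nth 0 [:: x; y; z] i.
have pD (Y : algebra K) (q : 'I_3 -> Y) (f g : mag K 'I_3) :
    peval q (f + g) = peval q f + peval q g.
  by rewrite -[f]scale1r peval_linear !scale1r.
split=> x y z.
  pose f : mag K 'I_3 :=
    delta K (rcomb 1) + delta K (rcomb (tperm 0 1)).
  have fE (Y : algebra K) (q : 'I_3 -> Y) : peval q f =
      amul (q 0) (amul (q 1) (q 2)) + amul (q 1) (amul (q 0) (q 2)).
    by rewrite pD !peval_delta /= !perm1 tpermL tpermR tpermD.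
  have fI : f \in identity3 (@is_ALR K).
    by apply/asboolP => Y [hY _] q; rewrite fE hY.
  by have := hX f fI (r x y z); rewrite fE.
pose f : mag K 'I_3 :=
  delta K (lcomb 1) + delta K (lcomb (tperm 1 2)).
have fE (Y : algebra K) (q : 'I_3 -> Y) : peval q f =
    amul (amul (q 0) (q 1)) (q 2) + amul (amul (q 0) (q 2)) (q 1).
  by rewrite pD !peval_delta /= !perm1 tpermL tpermR tpermD.
have fI : f \in identity3 (@is_ALR K).
  by apply/asboolP => Y [_ hY] q; rewrite fE hY.
by have := hX f fI (r x y z); rewrite fE.
Qed.

(* Main.v *)
Require Import Defs.
From mathcomp Require Import all_boot all_algebra reals complex.
From mathcomp Require Import all_fingroup boolp ring.

(* Pairing a monomial with its namesake costs the sign of the permutation of *)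
(* its variables, so a relation [m + m'], with [m'] obtained from [m] by one *)
(* transposition, is orthogonal to [g] exactly when [g] has the same         *)
(* coefficient on [m] and [m']; the polynomials with these symmetries are    *)
(* spanned by the very relations [m + m']. That ALR-algebras satisfy no      *)
(* other identity of degree 3 is seen on a 6-dimensional nilpotent algebra.  *)

Set Implicit Arguments.
Unset Strict Implicit.
Unset Printing Implicit Defensive.

Import GRing.Theory Num.Theory.
Local Open Scope ring_scope.

(** Let R be the space of cubic identities of ALR-algebras. Both R and its annihilator consist of
    the polynomials satisfying [ALR_sym], so R is its own annihilator; the two operads then coincide
    and the identity is the isomorphism. A test algebra gives R inside [ALR_sym]
    ([identity3_ALR_sym]), pairing with the defining relations gives the annihilator inside
    [ALR_sym] ([perp_ALR_sym]), and the converses ([ALR_sym_identity3], [ALR_sym_pairing]) are sums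
    over S_3 whose terms cancel. *)

Lemma quad_data_ext (K : fieldType) (R S : quad_data K) : qrel R =i qrel S -> R = S.
Proof.
case: R S => [R Rs Ra] [S Ss Sa] /= RS.
have E : R = S by apply/funext => f; exact: RS.
by move: Ss Sa; rewrite -E => Ss Sa; congr QuadData; exact: Prop_irrelevance.
Qed.

Lemma quad_operad_iso_eq (K : fieldType) (R S : quad_data K) : R = S ->
  exists phi : operad_iso (quad_operad R) (quad_operad S),
    phi 'I_2 (quad_gen R) = quad_gen S.
Proof.
move=> <-; have id_bij (A : finType) : bijective (@id (quad_operad R A)).
  by exists id.
by exists (@OperadIso K _ _ (fun A => id) (fun A a u v => erefl) id_bij
  (fun A B h hh l => erefl) erefl (fun A B a l m => erefl)).
Qed.

(** * The twelve multilinear monomials of degree 3 *)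

Lemma perm3P (s u : 'S_3) :
  reflect (s = u) [&& s 0 == u 0, s 1 == u 1 & s 2 == u 2].
Proof.
apply: (iffP and3P) => [[/eqP e0 /eqP e1 /eqP e2]|->]; last by split.
apply/permP => -[[|[|[|//]]] i3].
- by rewrite (_ : Ordinal i3 = 0) //; apply: val_inj.
- by rewrite (_ : Ordinal i3 = 1) //; apply: val_inj.
- by rewrite (_ : Ordinal i3 = 2) //; apply: val_inj.
Qed.

Lemma perm3_ex (x y z : 'I_3) : uniq [:: x; y; z] ->
  exists s : 'S_3, [/\ s 0 = x, s 1 = y & s 2 = z].
Proof.
move=> xyz; have inj : injective (fun i : 'I_3 => nth 0 [:: x; y; z] i).
  by move=> i j /eqP; rewrite nth_uniq // => /eqP /val_inj.
by exists (perm inj); rewrite !permE.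
Qed.

Lemma lcombE s : val (lcomb s) = Node (Node (Leaf (s 0)) (Leaf (s 1))) (Leaf (s 2)).
Proof. by []. Qed.

Lemma rcombE s : val (rcomb s) = Node (Leaf (s 0)) (Node (Leaf (s 1)) (Leaf (s 2))).
Proof. by []. Qed.

Lemma lcomb_inj : injective lcomb.
Proof.
by move=> s u /(congr1 val); rewrite !lcombE => -[e0 e1 e2];
  apply/perm3P; rewrite e0 e1 e2 !eqxx.
Qed.

Lemma rcomb_inj : injective rcomb.
Proof.
by move=> s u /(congr1 val); rewrite !rcombE => -[e0 e1 e2];
  apply/perm3P; rewrite e0 e1 e2 !eqxx.
Qed.

Lemma lcomb_neq_rcomb s u : (lcomb s == rcomb u) = false.
Proof. by apply/eqP => /(congr1 val). Qed.

Definition comb (s : 'S_3 + 'S_3) : mtree 'I_3 :=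
  match s with inl u => lcomb u | inr u => rcomb u end.

Lemma comb_inj : injective comb.
Proof.
move=> [s|s] [u|u] /= e.
- by rewrite (lcomb_inj e).
- by move/eqP: e; rewrite lcomb_neq_rcomb.
- by move/esym/eqP: e; rewrite lcomb_neq_rcomb.
- by rewrite (rcomb_inj e).
Qed.

Lemma comb_surj t : exists s, comb s = t.
Proof.
have pe := multilin_perm (valP t).
have ut : uniq (leaves (val t)) by rewrite (perm_uniq pe) enum_uniq.
have := perm_size pe; rewrite -cardE card_ord.
(* Each unexplored subtree has at least one leaf, so every shape but the two combs has a leaf count
   other than 3. *)
case Et: (val t) ut => [a|[a|[a|l1 l2] [b|r1 r2]] [c|[c|m1 m2] [d|n1 n2]]] //=;
  rewrite ?size_cat /= ?size_cat;
  do ?[match goal with |- context [size (leaves ?x)] =>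
    have := leaves_gt0 x; case: (size (leaves x)) => // ? _ end];
  rewrite ?addnS ?addSn //.
- move=> u3 _; have [s [e0 e1 e2]] := perm3_ex u3.
  by exists (inr s); apply: val_inj; rewrite Et rcombE e0 e1 e2.
- move=> u3 _; have [s [e0 e1 e2]] := perm3_ex u3.
  by exists (inl s); apply: val_inj; rewrite Et lcombE e0 e1 e2.
Qed.

Lemma sum_mtree3 (V : nmodType) (F : mtree 'I_3 -> V) :
  \sum_t F t = \sum_s F (lcomb s) + \sum_s F (rcomb s).
Proof.
have [g gK] := choice comb_surj.
rewrite (reindex comb) ?big_sumType //.
by apply: onW_bij; exists g => // s; apply: comb_inj; rewrite gK.
Qed.

(** Reindexing by left multiplication by [p] shows that the sum equals its opposite. *)
Lemma sum_antisym (K : fieldType) (V : lmodType K) (gT : finGroupType) (p : gT)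
  (F : gT -> V) : 2 != 0 :> K -> (forall s, F (p * s)%g = - F s) -> \sum_s F s = 0.
Proof.
move=> K2 Fp; set S := \sum_s _.
have SN : S = - S.
  by rewrite {1}/S (reindex_inj (mulgI p)) -sumrN; apply: eq_bigr => s _.
have : 2 *: S = 0 by rewrite scaler_nat mulr2n {1}SN addNr.
by move=> /eqP; rewrite scaler_eq0 (negbTE K2) => /eqP.
Qed.

(** * A nilpotent algebra separating the identities *)

Section TestAlgebra.
Variable K : fieldType.

(* With basis [a, b, c, d, e, t], the nonzero products of basis vectors are  *)
(* [ac = d], [bc = e], [ae = t] and [bd = - t]: then [a(bc) = - b(ac) = t]   *)
(* and all products [(xy)z] vanish.                                          *)
Definition test_mul (x y : 'rV[K]_6) : 'rV[K]_6 :=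
  \row_i [:: 0; 0; 0; x 0 0 * y 0 2; x 0 1 * y 0 2;
             x 0 0 * y 0 4 - x 0 1 * y 0 3]`_i.

Lemma test_linearl y : linear (fun x => test_mul x y).
Proof.
move=> k x x'; apply/rowP => i; rewrite !mxE.
by case: i => -[|[|[|[|[|[|//]]]]]] i6 /=; ring.
Qed.

Lemma test_linearr x : linear (test_mul x).
Proof.
move=> k y y'; apply/rowP => i; rewrite !mxE.
by case: i => -[|[|[|[|[|[|//]]]]]] i6 /=; ring.
Qed.

Definition test_alg : algebra K := Algebra test_linearl test_linearr.

(** The only possibly nonzero coordinate of x(yz) is a 2 by 2 minor of x and y times a coordinate of
    z, hence alternating in x and y. *)
Lemma test_ALR : is_ALR test_alg.
Proof.
split=> x y z; apply/rowP => i; rewrite !mxE;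
  by case: i => -[|[|[|[|[|[|//]]]]]] i6 /=; ring.
Qed.

(** Passing to the opposite product exchanges the two ALR identities, so the test algebra also
    serves for the monomials (xy)z. *)
Definition opp_alg (X : algebra K) : algebra K :=
  @Algebra K X (fun x y => amul y x) (@amul_linearr K X) (@amul_linearl K X).

Lemma opp_ALR (X : algebra K) : is_ALR X -> is_ALR (opp_alg X).
Proof. by move=> [hl hr]; split=> x y z; [exact: hr | exact: hl]. Qed.

Definition test_val (i j k x : 'I_3) : 'rV[K]_6 :=
  \row_h [:: (x == i)%:R; (x == j)%:R; (x == k)%:R; 0; 0; 0]`_h.

End TestAlgebra.

(** * Identities, symmetric coefficients and orthogonality *)

Section Identities.
Variable K : fieldType.
Local Notation p01 := (tperm 0 1 : 'S_3).
Local Notation p12 := (tperm 1 2 : 'S_3).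
Local Notation coef f t := ((f : fvect K (mtree 'I_3)) t).

(** As [(p * s) i = s (p i)], left multiplication permutes positions: [p12] swaps the last two
    factors of (xy)z, and [p01] the first two of x(yz). *)
Definition ALR_sym (f : mag K 'I_3) : Prop :=
  (forall s, coef f (lcomb (p12 * s)%g) = coef f (lcomb s)) /\
  (forall s, coef f (rcomb (p01 * s)%g) = coef f (rcomb s)).

Lemma tperm01E (s : 'S_3) : let u := (p01 * s)%g in
  [/\ u 0 = s 1, u 1 = s 0 & u 2 = s 2].
Proof. by rewrite /= !permM tpermL tpermR tpermD. Qed.

Lemma tperm12E (s : 'S_3) : let u := (p12 * s)%g in
  [/\ u 0 = s 0, u 1 = s 2 & u 2 = s 1].
Proof. by rewrite /= !permM tpermL tpermR tpermD. Qed.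

Lemma odd_tpermM (x y : 'I_3) (s : 'S_3) : x != y ->
  odd_perm (tperm x y * s) = ~~ odd_perm s.
Proof. by move=> xy; rewrite odd_permM odd_tperm xy. Qed.

Lemma pevalE (X : algebra K) (r : 'I_3 -> X) (f : mag K 'I_3) : peval r f =
  \sum_s coef f (lcomb s) *: amul (amul (r (s 0)) (r (s 1))) (r (s 2)) +
  \sum_s coef f (rcomb s) *: amul (r (s 0)) (amul (r (s 1)) (r (s 2))).
Proof. by rewrite /peval sum_mtree3. Qed.

Lemma sum_coef (g : 'S_3 -> K) (s s' : 'S_3) :
  \sum_u g u * ((u == s)%:R - (u == s')%:R) = g s - g s'.
Proof.
have E v : \sum_u g u * (u == v)%:R = g v.
  rewrite (bigD1 v) //= eqxx mulr1 big1 ?addr0 // => u /negbTE ->.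
  by rewrite mulr0.
by under eq_bigr do rewrite mulrBr; rewrite sumrB !E.
Qed.

Lemma perm3_eqE (s u : 'S_3) :
  (u 0 == s 0)%:R * ((u 1 == s 1)%:R * (u 2 == s 2)%:R) = (u == s)%:R :> K.
Proof. by rewrite (sameP eqP (perm3P u s)) -!natrM !mulnb. Qed.

(** Substituting a, b, c for the variables of one monomial gives it the value t, its transposed
    partner the value -t, and every other monomial t-coordinate 0; the t-coordinate of [f] is thus a
    difference of two coefficients. *)
Lemma identity3_ALR_sym f : f \in identity3 (@is_ALR K) -> ALR_sym f.
Proof.
move=> /asboolP hf; split=> s.
  (* The variables are listed backwards because the opposite product reads (xy)z as z(yx). *)
  have := hf _ (opp_ALR (@test_ALR K)) (test_val K (s 2) (s 1) (s 0)).
  have [e0 e1 e2] := tperm12E s.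
  rewrite pevalE => /rowP/(_ 5); rewrite [RHS]mxE [LHS]mxE !summxE.
  rewrite [X in _ + X]big1 => [|u _].
    rewrite addr0.
    under eq_bigr => u _.
      rewrite !mxE /=.
      rewrite (_ : _ - _ = (u == s)%:R - (u == (p12 * s)%g)%:R); last first.
        by rewrite -!perm3_eqE e0 e1 e2; ring.
      over.
    by rewrite sum_coef => /eqP; rewrite subr_eq0 => /eqP.
  by rewrite !mxE /=; ring.
have := hf _ (@test_ALR K) (test_val K (s 0) (s 1) (s 2)).
have [e0 e1 e2] := tperm01E s.
rewrite pevalE => /rowP/(_ 5); rewrite [RHS]mxE [LHS]mxE !summxE.
rewrite [X in X + _]big1 => [|u _].
  rewrite add0r.
  under eq_bigr => u _.
    rewrite !mxE /=.
    rewrite (_ : _ - _ = (u == s)%:R - (u == (p01 * s)%g)%:R); last first.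
      by rewrite -!perm3_eqE e0 e1 e2; ring.
    over.
  by rewrite sum_coef => /eqP; rewrite subr_eq0 => /eqP.
by rewrite !mxE /=; ring.
Qed.

Hypothesis K2 : 2 != 0 :> K.

Lemma ALR_sym_identity3 f : ALR_sym f -> f \in identity3 (@is_ALR K).
Proof.
move=> [fl fr]; apply/asboolP => X [Xl Xr] r; rewrite pevalE.
rewrite (sum_antisym (p := p12) K2) ?add0r => [|s].
  apply: (sum_antisym (p := p01) K2) => s.
  have [-> -> ->] := tperm01E s; rewrite fr -scalerN; congr (_ *: _).
  by apply/eqP; rewrite -addr_eq0 Xl.
have [-> -> ->] := tperm12E s; rewrite fl -scalerN; congr (_ *: _).
by apply/eqP; rewrite -addr_eq0 Xr.
Qed.

(** The transposition preserves both coefficients and flips the sign of the permutation, so the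
    terms cancel in pairs. *)
Lemma ALR_sym_pairing f g : ALR_sym f -> ALR_sym g -> @pairing K f g = 0.
Proof.
move=> [fl fr] [gl gr]; rewrite /pairing.
under eq_bigr do rewrite mulrBr.
rewrite sumrB (@sum_antisym K K^o _ (p12)) // => [|s].
  rewrite (@sum_antisym K K^o _ (p01)) ?subr0 // => s.
  by rewrite fr gr odd_tpermM // signrN mulNr.
by rewrite fl gl odd_tpermM // signrN mulNr.
Qed.

Lemma pairingDl f f' g : @pairing K (f + f') g = pairing f g + pairing f' g.
Proof.
rewrite /pairing -big_split; apply: eq_bigr => s _ /=.
by rewrite !ffunE -mulrDr !mulrDl opprD addrACA.
Qed.

Lemma pairing_lcomb s g :
  pairing (delta K (lcomb s)) g = (-1) ^+ s * coef g (lcomb s).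
Proof.
rewrite /pairing (bigD1 s) //= big1 ?addr0 => [|u us]; rewrite !ffunE.
  by rewrite eqxx eq_sym lcomb_neq_rcomb mul1r mul0r subr0.
by rewrite (inj_eq lcomb_inj) (negbTE us) eq_sym lcomb_neq_rcomb !mul0r subr0 mulr0.
Qed.

Lemma pairing_rcomb s g :
  pairing (delta K (rcomb s)) g = - ((-1) ^+ s * coef g (rcomb s)).
Proof.
rewrite /pairing (bigD1 s) //= big1 ?addr0 => [|u us]; rewrite !ffunE.
  by rewrite eqxx lcomb_neq_rcomb mul1r mul0r sub0r mulrN.
by rewrite (inj_eq rcomb_inj) (negbTE us) lcomb_neq_rcomb !mul0r subr0 mulr0.
Qed.

Lemma pevalD_delta (X : algebra K) (r : 'I_3 -> X) t u :
  peval r (delta K t + delta K u : mag K 'I_3) = teval r (val t) + teval r (val u).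
Proof. by rewrite -[delta K t]scale1r peval_linear scale1r !peval_delta. Qed.

(** A defining relation pairs with [g] to a sign times the difference of the coefficients of [g] on
    its two monomials. *)
Lemma perp_ALR_sym g : g \in perp (variety_rel (@is_ALR K)) -> ALR_sym g.
Proof.
move=> /asboolP hg; split=> s.
  have := hg (delta K (lcomb s) + delta K (lcomb (p12 * s)%g)).
  rewrite (pairingDl (delta K _) (delta K _)) pairing_lcomb pairing_lcomb.
  rewrite odd_tpermM // signrN mulNr -mulrBr => h.
  apply/esym/eqP; rewrite -subr_eq0; apply/eqP/(@lreg_sign K s).
  rewrite mulr0 h //; apply/asboolP => X [Xl Xr] r.
  by rewrite pevalD_delta !lcombE /=; have [-> -> ->] := tperm12E s.
have := hg (delta K (rcomb s) + delta K (rcomb (p01 * s)%g)).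
rewrite (pairingDl (delta K _) (delta K _)) pairing_rcomb pairing_rcomb.
rewrite odd_tpermM // signrN mulNr -opprD -mulrBr => h.
apply/esym/eqP; rewrite -subr_eq0; apply/eqP/(@lreg_sign K s).
rewrite mulr0; apply: oppr_inj; rewrite oppr0 h //; apply/asboolP => X [Xl Xr] r.
by rewrite pevalD_delta !rcombE /=; have [-> -> ->] := tperm01E s.
Qed.

Lemma quad_dual_ALR :
  quad_dual (variety_rel (@is_ALR K)) = variety_rel (@is_ALR K).
Proof.
apply: quad_data_ext => g; apply/idP/idP => hg.
  exact/ALR_sym_identity3/perp_ALR_sym.
apply/asboolP => f hf.
by apply: ALR_sym_pairing; apply: identity3_ALR_sym.
Qed.

End Identities.

Theorem proposition51 (R : realType) :
  exists phi : operad_iso (dual_operad (@is_ALR (complex R)))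
                          (governed_operad (@is_ALR (complex R))),
    phi 'I_2 (quad_gen (quad_dual (variety_rel (@is_ALR (complex R))))) =
    quad_gen (variety_rel (@is_ALR (complex R))).
Proof. by apply/quad_operad_iso_eq/quad_dual_ALR; rewrite pnatr_eq0. Qed.
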